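(* Let $T$ be an integral domain, $M$ a maximal ideal of $T$, $K=T/M$, $\varphi:T\to K$ the canonical epimorphism, $D$ a proper subring of $K$, $k$ the quotient field of $D$ (taken inside $K$), and $R=\varphi^{-1}(D)$. Then $R$ is a locally GK-domain if and only if $D$ and $T$ are locally GK-domains, $T_M$ is a valuation domain and $k=K$.
   Context: For a property $\mathcal{X}$ of integral domains, a domain $D$ is a locally $\mathcal{X}$-domain if $D_P$ has $\mathcal{X}$ for every prime ideal $P$ of $D$. For a nonzero fractional ideal $I$ of a domain $D$ with quotient field $F$, put $I^{-1}=\{a\in F \mid aI\subseteq D\}$, $I_v=(I^{-1})^{-1}$ and $I_t=\bigcup\{J_v \mid J \text{ a nonzero finitely generated fractional subideal of } I\}$; $I$ is a $t$-ideal if $I_t=I$, and a maximal $t$-ideal is an ideal maximal among the proper (nonzero) $t$-ideals. A valuation domain is strongly discrete if it has no nonzero prime ideal $P$ with $P=P^2$. A GK-domain (generalized Krull domain in the sense of El Baghdadi) is a domain $D$ such that $D_N$ is a strongly discrete valuation domain for every maximal $t$-ideal $N$ of $D$ and every principal ideal of $D$ has only finitely many minimal prime ideals. Fields count as valuation domains and as GK-domains.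
   Formalization: The maximal ideal M is assumed nonzero (T is not a field); without this the claim fails, e.g. T = Q(x), M = 0, D = Z gives R = Z, which is locally GK although k = Q is not K. *)

(* Defs.v *)
From HB Require Import structures.
From mathcomp Require Import all_boot all_order all_algebra.
From mathcomp Require Import generic_quotient ring_quotient.
From mathcomp Require Import boolp classical_sets functions cardinality.

Set Implicit Arguments.
Unset Strict Implicit.
Unset Printing Implicit Defensive.

Import GRing.Theory.

Local Open Scope classical_set_scope.
Local Open Scope ring_scope.

(* An integral domain is represented as a subring [A : set F] of a field [F].
   The field [F] may be larger than the quotient field of [A]; every notion
   below that refers to the quotient field uses [quotient_field A].  Ideals and
   fractional ideals of [A], and its localizations, are subsets of [F] too. *)

Definition is_subring (R : nzRingType) (A : set R) : Prop :=
  subring_closed (mem A).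

Definition quotient_field (F : fieldType) (A : set F) : set F :=
  [set x | exists a b, [/\ A a, A b, b != 0 & x = a / b]].

Definition submodule (F : fieldType) (A I : set F) : Prop :=
  [/\ I 0, forall x y, I x -> I y -> I (x + y)
    & forall a x, A a -> I x -> I (a * x)].

Definition is_ideal (F : fieldType) (A I : set F) : Prop :=
  I `<=` A /\ submodule A I.

Definition prime_ideal (F : fieldType) (A P : set F) : Prop :=
  [/\ is_ideal A P, ~ P 1
    & forall x y, A x -> A y -> P (x * y) -> P x \/ P y].

Definition localization (F : fieldType) (A P : set F) : set F :=
  [set x | exists a s, [/\ A a, A s, ~ P s & x = a / s]].

Definition principal_ideal (F : fieldType) (A : set F) (a : F) : set F :=
  [set a * x | x in A].

Definition minimal_prime (F : fieldType) (A I P : set F) : Prop :=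
  [/\ prime_ideal A P, I `<=` P
    & forall Q, prime_ideal A Q -> I `<=` Q -> Q `<=` P -> Q = P].

Definition ideal_mul (F : fieldType) (I J : set F) : set F :=
  [set x | exists (n : nat) (u v : 'I_n -> F),
     [/\ forall i, I (u i), forall i, J (v i) & x = \sum_(i < n) u i * v i]].

Definition valuation_domain (F : fieldType) (V : set F) : Prop :=
  is_subring V /\
  forall x, quotient_field V x -> x != 0 -> V x \/ V x^-1.

Definition strongly_discrete (F : fieldType) (V : set F) : Prop :=
  ~ exists P, [/\ prime_ideal V P, P <> [set 0] & P = ideal_mul P P].

Definition fractional_ideal (F : fieldType) (A I : set F) : Prop :=
  [/\ I `<=` quotient_field A, submodule A I
    & exists d, [/\ A d, d != 0 & forall x, I x -> A (d * x)]].

Definition gen_submodule (F : fieldType) (A : set F) (n : nat)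
    (g : 'I_n -> F) : set F :=
  [set x | exists a : 'I_n -> F,
     (forall i, A (a i)) /\ x = \sum_(i < n) a i * g i].

Definition finitely_generated (F : fieldType) (A J : set F) : Prop :=
  exists (n : nat) (g : 'I_n -> F), J = gen_submodule A g.

Definition ideal_inv (F : fieldType) (A I : set F) : set F :=
  [set a | quotient_field A a /\ forall x, I x -> A (a * x)].

Definition v_closure (F : fieldType) (A I : set F) : set F :=
  ideal_inv A (ideal_inv A I).

Definition t_closure (F : fieldType) (A I : set F) : set F :=
  \bigcup_(J in [set J | [/\ fractional_ideal A J, J <> [set 0],
                             finitely_generated A J & J `<=` I]])
    v_closure A J.

Definition t_ideal (F : fieldType) (A I : set F) : Prop :=
  [/\ fractional_ideal A I, I <> [set 0] & t_closure A I = I].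

Definition proper_t_ideal (F : fieldType) (A I : set F) : Prop :=
  [/\ t_ideal A I, I `<=` A & I <> A].

Definition maximal_t_ideal (F : fieldType) (A N : set F) : Prop :=
  proper_t_ideal A N /\
  forall I, proper_t_ideal A I -> N `<=` I -> I = N.

Definition GK_domain (F : fieldType) (A : set F) : Prop :=
  [/\ is_subring A,
      forall N, maximal_t_ideal A N ->
        valuation_domain (localization A N) /\
        strongly_discrete (localization A N)
    & forall a, A a ->
        finite_set [set P | minimal_prime A (principal_ideal A a) P]].

Definition locally (F : fieldType) (X : set F -> Prop) (A : set F) : Prop :=
  forall P, prime_ideal A P -> X (localization A P).

(* [idealr T] and [idealr_closed] are MathComp's *proper* ideals. *)
Definition maximal_idealr (T : comNzRingType) (M : idealr T) : Prop :=
  forall J : {pred T}, idealr_closed J -> {subset M <= J} -> J =i M.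

(* The proof of maximality is a (phantom) parameter of the type so that the
   field structure on the quotient ring [{ideal_quot M}] can be inferred. *)
Definition residue_field (T : comNzRingType) (M : idealr T)
  of maximal_idealr M : Type := {ideal_quot M}.

HB.instance Definition _ (T : comNzRingType) (M : idealr T)
    (hM : maximal_idealr M) :=
  GRing.ComNzRing.copy (residue_field hM) {ideal_quot M}.

Definition residue_map (T : comNzRingType) (M : idealr T)
    (hM : maximal_idealr M) : T -> residue_field hM :=
  \pi_{ideal_quot M}%qT.

HB.instance Definition _ (T : comNzRingType) (M : idealr T)
    (hM : maximal_idealr M) :=
  GRing.RMorphism.copy (residue_map hM)
    (\pi_{ideal_quot M}%qT : T -> {ideal_quot M}).

Lemma residue_map_surj (T : comNzRingType) (M : idealr T)
  (hM : maximal_idealr M) (x : residue_field hM) :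
  exists a, residue_map hM a = x.
Proof. by exists (repr (x : {ideal_quot M})); exact: reprK. Qed.

Lemma residue_map_eq0 (T : comNzRingType) (M : idealr T)
  (hM : maximal_idealr M) (a : T) : (residue_map hM a == 0) = (a \in M).
Proof.
rewrite -[in RHS](subr0 a) Quotient.idealrBE -(rmorph0 (residue_map hM)).
by [].
Qed.

Lemma residue_inv_ex (T : comNzRingType) (M : idealr T)
    (hM : maximal_idealr M) (x : residue_field hM) :
  x != 0 -> exists y, y * x = 1.
Proof.
case: (residue_map_surj x) => a <- {x}; rewrite residue_map_eq0 => aM.
apply: contrapT => noinv.
pose J : {pred T} := [pred t | `[< exists m r, m \in M /\ t = m + r * a >]].
have JM : J =i M.
  apply: (hM); last first.
    move=> m mM; apply/asboolP; exists m, 0.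
    by rewrite mul0r addr0.
  split.
  - by apply/asboolP; exists 0, 0; rewrite mul0r addr0 rpred0.
  - apply/asboolP => -[m [r [mM e]]]; apply: noinv.
    exists (residue_map hM r).
    have /eqP m0 : residue_map hM m == 0 by rewrite residue_map_eq0.
    have := congr1 (residue_map hM) e.
    by rewrite rmorph1 rmorphD rmorphM /= m0 add0r => <-.
  - move=> b u v /asboolP[m [r [mM ->]]] /asboolP[m' [r' [m'M ->]]].
    apply/asboolP; exists (b * m + m'), (b * r + r'); split.
      by rewrite rpredD// idealMr.
    by rewrite mulrDr mulrDl mulrA addrACA.
move: aM; rewrite -JM => /negP; apply; apply/asboolP; exists 0, 1.
by rewrite mul1r add0r rpred0.
Qed.

Definition residue_inv (T : comNzRingType) (M : idealr T)
    (hM : maximal_idealr M) (x : residue_field hM) : residue_field hM :=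
  if pselect (exists y, y * x = 1) is left e then sval (cid e) else 0.

Lemma residue_mulVf (T : comNzRingType) (M : idealr T)
  (hM : maximal_idealr M) (x : residue_field hM) :
  x != 0 -> residue_inv x * x = 1.
Proof.
move=> x0; rewrite /residue_inv; case: pselect => [e|/(_ (residue_inv_ex x0))//].
exact: (svalP (cid e)).
Qed.

Lemma residue_invr0 (T : comNzRingType) (M : idealr T)
  (hM : maximal_idealr M) : residue_inv (0 : residue_field hM) = 0.
Proof.
rewrite /residue_inv; case: pselect => // e; exfalso; case: e => y /eqP.
by rewrite mulr0 eq_sym oner_eq0.
Qed.

HB.instance Definition _ (T : comNzRingType) (M : idealr T)
    (hM : maximal_idealr M) :=
  GRing.ComNzRing_isField.Build (residue_field hM)
    (@residue_mulVf T M hM) (@residue_invr0 T M hM).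

(* Main.v *)
Require Import Defs.
From HB Require Import structures.
From mathcomp Require Import all_boot all_order all_algebra.
From mathcomp Require Import generic_quotient ring_quotient.
From mathcomp Require Import boolp classical_sets functions cardinality.

Set Implicit Arguments.
Unset Strict Implicit.
Unset Printing Implicit Defensive.

Import GRing.Theory.
Local Open Scope classical_set_scope.
Local Open Scope ring_scope.

(** Localizing separates the problem.  A prime of [R] that does not contain [M]
    is the trace of a prime [Q] of [T], and an element of [M] outside [Q] serves
    as a common denominator that gives [R_P = T_Q]
    ([localization_pullback_away]).  A prime of [R] that contains [M] is the
    inverse image of a prime [p] of [D], and [R_P] is then the inverse image of
    [D_p] under the residue map [V -> K], where [V = T_M]
    ([localization_pullback_above]).  So everything happens in a local ring [V]
    with residue field [K] and nonzero maximal ideal [m], for the inverse image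
    [A] of a subring [E] of [K].

    An element of [V] outside [m] is a unit, hence divides all of [m].
    Therefore every ideal of [A] is comparable with [m]: the ideals above [m]
    are the inverse images of the ideals of [E], and the primes below [m] are
    primes of [V].  This yields that
    - [A] is a valuation domain iff [E] and [V] are and [E] has quotient field
      [K] ([pullback_valuation]); strong discreteness passes from [E] and [V] to
      [A] and from [A] to [E];
    - if [E <> K], then [m] is a t-ideal of [A] ([ker_proper_t]), so the maximal
      t-ideals of [A] contain [m]; if moreover [K] is the quotient field of [E],
      those strictly above [m] are the inverse images of the maximal t-ideals of
      [E] ([maximal_t_pullback]);
    - the minimal primes of [a A] correspond to those of [psi a E] when [a] is
      not in [m] ([minimal_prime_pullback]); when [a] is in [m], they lie below
      [m], where primes of a valuation domain [V] form a chain, so that there is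
      at most one.

    Hence [A] is a GK-domain as soon as [E <> K] and [V] are GK-domains, [V] is
    a valuation domain and [K] is the quotient field of [E] ([GK_pullback]).
    Conversely let [A] be a GK-domain with [E <> K].  Localizing [A] at a
    maximal t-ideal above [m] gives a valuation domain that is itself an inverse
    image, so [V] is a valuation domain and [K] is the quotient field of [E]
    ([GK_pullback_valuation]); then [E] is a GK-domain
    ([GK_residue_of_pullback]).  To apply this to [R] one needs a prime [p] of
    [D] with [D_p <> K]; a prime above the conductor of an element of [K]
    outside [D] is one ([exists_prime_localization_neqT]).  Finally [k = K]
    identifies [T_M] with the localization of [R] at [M]. *)

(** * Subrings, ideals and localizations inside a field *)

Lemma is_subringP (R : nzRingType) (A : set R) : is_subring A <->
  [/\ A 1, forall x y, A x -> A y -> A (x - y)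
    & forall x y, A x -> A y -> A (x * y)].
Proof.
split=> [[A1 AB AM]|[A1 AB AM]].
  split=> [|x y Ax Ay|x y Ax Ay]; apply/set_mem => //.
  - by apply: AB; apply/mem_set.
  - by apply: AM; apply/mem_set.
split=> [|x y /set_mem Ax /set_mem Ay|x y /set_mem Ax /set_mem Ay];
  apply/mem_set => //; [exact: AB|exact: AM].
Qed.

Section Subring.
Variables (R : nzRingType) (A : set R).
Hypothesis hA : is_subring A.

Lemma subring1 : A 1. Proof. by case/is_subringP: hA. Qed.

Lemma subringB x y : A x -> A y -> A (x - y).
Proof. by case/is_subringP: hA => _ + _; apply. Qed.

Lemma subringM x y : A x -> A y -> A (x * y).
Proof. by case/is_subringP: hA => _ _; apply. Qed.

Lemma subring0 : A 0.
Proof. by rewrite -(subrr 1); apply: subringB; exact: subring1. Qed.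

Lemma subringN x : A x -> A (- x).
Proof.
by move=> Ax; rewrite -sub0r; apply: subringB => //; exact: subring0.
Qed.

Lemma subringD x y : A x -> A y -> A (x + y).
Proof.
by move=> Ax Ay; rewrite -[y]opprK; apply: subringB => //; exact: subringN.
Qed.

End Subring.

Section Ideals.
Variables (F : fieldType) (A : set F).
Hypothesis hA : is_subring A.
Implicit Types I J P : set F.

Lemma submodule_sum I n (u : 'I_n -> F) : submodule A I ->
  (forall i, I (u i)) -> I (\sum_(i < n) u i).
Proof.
case=> I0 ID _ Iu.
by elim/big_ind : _ => // x y; exact: ID.
Qed.

Lemma ideal0 I : is_ideal A I -> I 0. Proof. by case=> _ []. Qed.

Lemma ideal_sub I x : is_ideal A I -> I x -> A x.
Proof. by case=> + _; apply. Qed.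

Lemma idealD I x y : is_ideal A I -> I x -> I y -> I (x + y).
Proof. by case=> _ [] _ + _; apply. Qed.

Lemma idealMl I a x : is_ideal A I -> A a -> I x -> I (a * x).
Proof. by case=> _ [] _ _; apply. Qed.

Lemma idealMr I a x : is_ideal A I -> A a -> I x -> I (x * a).
Proof. by move=> hI Aa Ix; rewrite mulrC; exact: idealMl. Qed.

Lemma ideal_eq_unit I : is_ideal A I -> I 1 -> I = A.
Proof.
move=> hI I1; apply/seteqP; split=> x; first exact: ideal_sub.
by move=> Ax; rewrite -[x]mulr1; apply: idealMl.
Qed.

Lemma principal_ideal_sub I a : is_ideal A I ->
  principal_ideal A a `<=` I <-> I a.
Proof.
move=> hI; split=> [aI|Ia _ [x Ax <-]]; last exact: (idealMr hI).
by apply: aI; exists 1; [exact: subring1|exact: mulr1].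
Qed.

Lemma prime_mul P x y : prime_ideal A P -> A x -> A y -> ~ P x -> ~ P y ->
  ~ P (x * y).
Proof. by case=> _ _ Pp Ax Ay Px Py /(Pp _ _ Ax Ay)[]. Qed.

Lemma prime_is_ideal P : prime_ideal A P -> is_ideal A P. Proof. by case. Qed.

Lemma prime_zero : prime_ideal A [set 0].
Proof.
split=> /=.
- split; first by move=> x /= ->; exact: subring0.
  split=> //= [x y -> ->|a x _ ->]; first by rewrite addr0.
  by rewrite mulr0.
- by move/eqP; rewrite oner_eq0.
- by move=> x y _ _ /eqP; rewrite mulf_eq0 => /orP[]/eqP; [left|right].
Qed.

Lemma sub_quotient_field : A `<=` quotient_field A.
Proof.
move=> x Ax; exists x, 1; rewrite divr1 oner_neq0; split=> //.
exact: subring1.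
Qed.

Lemma quotient_field_zero : localization A [set 0] = quotient_field A.
Proof.
apply/seteqP; split=> x [a [s [Aa As s0 ->]]]; exists a, s; split=> //=;
  exact/eqP.
Qed.

Lemma sub_localization P : ~ P 1 -> A `<=` localization A P.
Proof.
by move=> P1 x Ax; exists x, 1; rewrite divr1; split=> //; exact: subring1.
Qed.

Lemma localization_anti P Q : P `<=` Q ->
  localization A Q `<=` localization A P.
Proof.
by move=> PQ x [a [s [Aa As Qs ->]]]; exists a, s; split=> // /PQ.
Qed.

Lemma localization_quotient_field P : P 0 ->
  localization A P `<=` quotient_field A.
Proof.
by move=> P0; rewrite -quotient_field_zero; apply: localization_anti => x /= ->.
Qed.

End Ideals.

Lemma quotient_field_idem (F : fieldType) (A : set F) : is_subring A ->
  quotient_field (quotient_field A) `<=` quotient_field A.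
Proof.
move=> hA x [_ [_ [[a [b [Aa Ab b0 ->]]] [c [d [Ac Ad d0 ->]]] cd0 ->]]].
exists (a * d), (b * c); split; try exact: subringM.
  rewrite mulf_neq0//; apply: contraNN cd0 => /eqP ->.
  by rewrite mul0r.
by rewrite !invfM invrK [c^-1 * d]mulrC mulrACA.
Qed.

Lemma quotient_fieldS (F : fieldType) (A B : set F) : A `<=` B ->
  quotient_field A `<=` quotient_field B.
Proof.
by move=> AB x [a [b [Aa Ab b0 ->]]]; exists a, b; split=> //; exact: AB.
Qed.

(** If [x] is in [I] but not in [J], then [x / y] is never in [V] for [y] in
    [J], so [x] divides every element of [J]. *)
Lemma valuation_comparable (F : fieldType) (V I J : set F) :
  valuation_domain V -> is_ideal V I -> is_ideal V J ->
  I `<=` J \/ J `<=` I.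
Proof.
move=> [hV val] hI hJ; have [IJ|/nonsubset[x [Ix Jx]]] := pselect (I `<=` J).
  by left.
right=> y Jy; have [->|y0] := eqVneq y 0; first exact: ideal0 hI.
have [x0|x0] := eqVneq x 0; first by case: Jx; rewrite x0; exact: ideal0 hJ.
have : quotient_field V (x / y).
  by exists x, y; split=> //; [exact: ideal_sub Ix|exact: ideal_sub Jy].
move/val; rewrite mulf_neq0 ?invr_eq0// => /(_ isT)[Vxy|].
  by case: Jx; rewrite -(divfK y0 x); apply: (idealMl hJ).
by rewrite invfM invrK mulrC => Vyx; rewrite -(divfK x0 y); apply: (idealMl hI).
Qed.

Lemma valuation_overring (F : fieldType) (A B : set F) :
  valuation_domain A -> is_subring B -> A `<=` B -> B `<=` quotient_field A ->
  valuation_domain B.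
Proof.
move=> [hA val] hB AB BA; split=> // x Bx x0.
have [|/AB|/AB] := val x _ x0; [|by left|by right].
exact/quotient_field_idem/(quotient_fieldS BA).
Qed.

(** * Zorn's lemma for ideals *)

(** The proof applies Zorn's lemma to the [Y] whose union with [I] is in [C], so
    that the empty chain has the bound [I] and only nonempty chains are left to
    the user. *)
Lemma zorn_above (X : Type) (C : set (set X)) (I : set X) : C I ->
  (forall G : set (set X), G `<=` C -> G !=set0 -> total_on G subset ->
    C (\bigcup_(Y in G) Y)) ->
  exists N, [/\ C N, I `<=` N & forall Y, C Y -> N `<=` Y -> Y = N].
Proof.
move=> CI CU.
have [G GC Gtot|N [CN Nmax]] := @Zorn_bigcup X [set Y | C (I `|` Y)].
  have [->|G0] := eqVneq G set0; first by rewrite /= bigcup_set0 setU0.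
  have {}G0 : G !=set0 by apply/set0P.
  rewrite /=; have -> : I `|` \bigcup_(Y in G) Y = \bigcup_(Y in setU I @` G) Y.
    rewrite bigcup_image; apply/seteqP; split=> x.
      move=> [Ix|[Y GY Yx]]; last by exists Y => //; right.
      by have [Y GY] := G0; exists Y => //; left.
    by move=> [Y GY [Ix|Yx]]; [left|right; exists Y].
  apply: CU => [_ [Y GY <-]||_ _ [Y GY <-] [Z GZ <-]]; first exact: GC.
    by have [Y GY] := G0; exists (I `|` Y); exists Y.
  by have [YZ|ZY] := Gtot _ _ GY GZ; [left|right]; exact: setUS.
exists (I `|` N); split=> [//|x Ix|Y CY NY]; first by left.
have IY : I `<=` Y by move=> x Ix; apply: NY; left.
have {}NY : N `<=` Y by move=> x Nx; apply: NY; right.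
apply/seteqP; split=> [x Yx|x [/IY|/NY]//]; right.
apply: contrapT => Nx; apply: (Nmax Y).
  by split=> // /(_ _ Yx).
by have /= -> : I `|` Y = Y by exact/setUidPr.
Qed.

Lemma chain_finite (X : Type) (G : set (set X)) n (g : 'I_n -> X) :
  G !=set0 -> total_on G subset -> (forall i, (\bigcup_(Y in G) Y) (g i)) ->
  exists2 Y, G Y & forall i, Y (g i).
Proof.
move=> G0 Gtot; elim: n g => [|n IH] g Gg.
  by have [Y GY] := G0; exists Y => // -[].
have [Y GY Yg] := IH (g \o lift ord0) (fun i => Gg _).
have [Z GZ Zg] := Gg ord0.
have [YZ|ZY] := Gtot _ _ GY GZ.
  by exists Z => // i; have [j ->|->//] := unliftP ord0 i; apply/YZ/Yg.
by exists Y => // i; have [j ->|->] := unliftP ord0 i; [exact: Yg|exact: ZY].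
Qed.

Section BigcupIdeal.
Variables (F : fieldType) (A : set F) (G : set (set F)).
Hypotheses (G0 : G !=set0) (Gtot : total_on G subset).
Hypothesis GI : forall I, G I -> is_ideal A I.

Lemma bigcup_ideal : is_ideal A (\bigcup_(Y in G) Y).
Proof.
split; first by move=> x [Y /GI hY Yx]; exact: (ideal_sub hY).
split.
- by have [Y GY] := G0; exists Y => //; exact: (ideal0 (GI GY)).
- move=> x y [Y GY Yx] [Z GZ Zy].
  have [YZ|ZY] := Gtot GY GZ.
    by exists Z => //; apply: (idealD (GI GZ)) => //; exact: YZ.
  by exists Y => //; apply: (idealD (GI GY)) => //; exact: ZY.
- by move=> a x Aa [Y GY Yx]; exists Y => //; exact: (idealMl (GI GY)).
Qed.

End BigcupIdeal.

(** An ideal maximal among the proper ones is prime: if [x y] is in [P] and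
    [x] is not, then [P + A x] contains [1], and multiplying by [y] gives [y] in
    [P]. *)
Lemma exists_prime_above (F : fieldType) (A I : set F) : is_subring A ->
  is_ideal A I -> ~ I 1 -> exists2 P, prime_ideal A P & I `<=` P.
Proof.
move=> hA hI I1.
have [|G GC G0 Gtot|P [[hP P1] IP Pmax]] :=
    @zorn_above F [set J | is_ideal A J /\ ~ J 1] I; first by split.
  split; last by move=> [Y /GC[]].
  by apply: bigcup_ideal => // Y /GC[].
exists P => //; split=> // x y Ax Ay Pxy.
have [|Px] := pselect (P x); [by left|right].
pose J := [set z | exists p a, [/\ P p, A a & z = p + a * x]].
have PJ : P `<=` J.
  by move=> p Pp; exists p, 0; rewrite mul0r addr0; split=> //; exact: subring0.
have Jx : J x.
  exists 0, 1; rewrite mul1r add0r; split=> //; first exact: ideal0 hP.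
  exact: subring1.
have [[p [a [Pp Aa e]]]|J1] := pselect (J 1).
  rewrite -[y]mul1r e mulrDl; apply: (idealD hP).
    exact: (idealMr hP).
  by rewrite -mulrA; exact: (idealMl hP).
exfalso; apply: Px; rewrite -(Pmax J)//; split=> //; split.
  move=> _ [p [a [Pp Aa ->]]]; apply: subringD => //.
    exact: (ideal_sub hP).
  exact: subringM.
split; first exact/PJ/(ideal0 hP).
- move=> _ _ [p [a [Pp Aa ->]]] [q [b [Pq Ab ->]]].
  exists (p + q), (a + b); rewrite mulrDl addrACA; split=> //.
    exact: (idealD hP).
  exact: subringD.
- move=> c _ Ac [p [a [Pp Aa ->]]]; exists (c * p), (c * a).
  rewrite mulrDr mulrA; split=> //; first exact: (idealMl hP).
  exact: subringM.
Qed.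

(** * t-ideals by elements *)
Section Generated.
Variables (F : fieldType) (A : set F) (n : nat) (g : 'I_n -> F).
Hypothesis hA : is_subring A.

Lemma gen_submodule_mem j : gen_submodule A g (g j).
Proof.
exists (fun k => (k == j)%:R); split.
  by move=> k; case: eqP => _; [exact: subring1|exact: subring0].
rewrite (bigD1 j)//= eqxx mul1r big1 ?addr0// => k /negPf ->.
by rewrite mul0r.
Qed.

Lemma gen_submodule_sub I : submodule A I -> (forall i, I (g i)) ->
  gen_submodule A g `<=` I.
Proof.
move=> sI Ig _ [a [Aa ->]]; apply: (submodule_sum sI) => j.
by case: sI => _ _; apply.
Qed.

Lemma gen_submodule_closed : submodule A (gen_submodule A g).
Proof.
split.
- exists (fun=> 0); split; first by move=> _; exact: subring0.
  by rewrite big1// => k _; rewrite mul0r.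
- move=> _ _ [a [Aa ->]] [b [Ab ->]]; exists (fun k => a k + b k); split.
    by move=> k; exact: subringD.
  by rewrite -big_split; apply: eq_bigr => k _; rewrite mulrDl.
- move=> c _ Ac [a [Aa ->]]; exists (fun k => c * a k); split.
    by move=> k; exact: subringM.
  by rewrite big_distrr; apply: eq_bigr => k _; rewrite /= mulrA.
Qed.

Lemma gen_submodule_neq0 :
  (exists i, g i != 0) <-> gen_submodule A g <> [set 0].
Proof.
split=> [[i gi] J0|J0].
  by have := gen_submodule_mem i; rewrite J0 /= => /eqP; apply/negP.
apply: contrapT => g0; apply: J0.
have {}g0 i : g i = 0.
  by apply/eqP/negPn/negP => gi; apply: g0; exists i.
apply/seteqP; split=> [y [a [_ ->]]|y ->] /=.
  by rewrite big1// => i _; rewrite g0 mulr0.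
by case: gen_submodule_closed.
Qed.

(** As [1] multiplies the generators into [A], the condition on the right puts
    [x] itself in [A], hence in the quotient field. *)
Lemma v_closure_gen x : (forall i, A (g i)) ->
  v_closure A (gen_submodule A g) x <->
  forall y, quotient_field A y -> (forall i, A (y * g i)) -> A (y * x).
Proof.
move=> Ag; have sA : submodule A A.
  by split; [exact: subring0|exact: subringD|exact: subringM].
split=> [[Qx xP] y Qy Ay|xP].
  rewrite mulrC; apply: xP; split=> // _ [a [Aa ->]].
  rewrite mulr_sumr; apply: (submodule_sum sA) => i.
  by rewrite mulrCA; exact: subringM.
split=> [|y [Qy Ay]].
  apply: sub_quotient_field => //; rewrite -[x]mul1r; apply: xP.
    by apply: sub_quotient_field => //; exact: subring1.
  by move=> i; rewrite mul1r.
by rewrite mulrC; apply: xP => // i; apply: Ay; exact: gen_submodule_mem.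
Qed.

End Generated.

(** For an integral ideal [I], being a t-ideal amounts to this elementary
    closure property, in which [J_v] is tested on generators [g] of [J] and
    fractional ideals are no longer mentioned. *)
Definition t_closed (F : fieldType) (A I : set F) : Prop :=
  forall n (g : 'I_n -> F) x, (forall i, I (g i)) -> (exists i, g i != 0) ->
    (forall y, quotient_field A y -> (forall i, A (y * g i)) -> A (y * x)) ->
    I x.

Lemma submodule_fractional (F : fieldType) (A J : set F) : is_subring A ->
  J `<=` A -> submodule A J -> fractional_ideal A J.
Proof.
move=> hA JA sJ; split=> //; first by move=> x /JA; exact: sub_quotient_field.
exists 1; split; [exact: subring1|exact: oner_neq0|].
by move=> y /JA; rewrite mul1r.
Qed.

Lemma proper_t_idealP (F : fieldType) (A I : set F) : is_subring A ->
  proper_t_ideal A I <->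
  [/\ is_ideal A I, ~ I 1, I <> [set 0] & t_closed A I].
Proof.
move=> hA; split.
  move=> [[[_ sI _] I0 tI] IA Ine].
  have hI : is_ideal A I by [].
  split=> // [I1|n g x Ig g0 xP]; first by apply: Ine; exact: ideal_eq_unit.
  rewrite -tI; exists (gen_submodule A g).
    have JI : gen_submodule A g `<=` I by exact: gen_submodule_sub.
    split=> //; last by exists n, g.
      apply: submodule_fractional => //; first exact: subset_trans IA.
      exact: gen_submodule_closed.
    exact/gen_submodule_neq0.
  by apply/v_closure_gen => // i; exact/IA.
move=> [hI I1 I0 tI].
have IA : I `<=` A by case: hI.
split=> //; last by move=> IAe; apply: I1; rewrite IAe; exact: subring1.
split=> //; first by apply: submodule_fractional => //; case: hI.
apply/seteqP; split.
  move=> x [J [_ J0 [n [g eJ]] JI]]; rewrite eJ in J0 JI *.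
  have Ig i : I (g i) by apply/JI/gen_submodule_mem.
  move=> /v_closure_gen -/(_ hA (fun i => IA _ (Ig i))).
  by apply: tI => //; exact/(gen_submodule_neq0 _ hA).
move=> x Ix.
have [e Ie e0] : exists2 e, I e & e != 0.
  apply: contrapT => e0; apply: I0; apply/seteqP; split=> y /=; last first.
    by move=> ->; exact: ideal0 hI.
  by move=> Iy; apply/eqP/negPn/negP => y0; apply: e0; exists y.
(* The second generator keeps the ideal nonzero when [x = 0]. *)
pose g (i : 'I_2) := if i == ord0 then x else e.
have Ig i : I (g i) by rewrite /g; case: ifP.
exists (gen_submodule A g).
  have JI : gen_submodule A g `<=` I.
    by apply: gen_submodule_sub => //; case: hI.
  split=> //; last by exists 2%N, g.
    apply: submodule_fractional => //; first exact: subset_trans IA.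
    exact: gen_submodule_closed.
  by apply/gen_submodule_neq0 => //; exists (lift ord0 ord0).
apply/v_closure_gen => // [i|y _ /(_ ord0)//]; exact/IA.
Qed.

(** Finite families in the union of a chain lie in one member, so a union of a
    chain of t-closed ideals is t-closed and Zorn's lemma applies. *)
Lemma exists_maximal_t (F : fieldType) (A I : set F) : is_subring A ->
  proper_t_ideal A I -> exists2 N, maximal_t_ideal A N & I `<=` N.
Proof.
move=> hA tI.
have [//| |N [tN IN Nmax]] := @zorn_above F (proper_t_ideal A) I; last first.
  by exists N.
move=> G GC G0 Gtot; apply/proper_t_idealP => //.
have {}GC Y : G Y -> [/\ is_ideal A Y, ~ Y 1, Y <> [set 0] & t_closed A Y].
  by move=> /GC /proper_t_idealP; apply.
split.
- by apply: bigcup_ideal => // Y /GC[].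
- by case=> Y /GC[].
- have [Y GY] := G0; have [hY _ Y0 _] := GC _ GY => U0; apply: Y0.
  apply/seteqP; split=> [x Yx|x ->]; last exact: (ideal0 hY).
  by rewrite -U0; exists Y.
- move=> n g x Gg g0 xP; have [Y GY Yg] := chain_finite G0 Gtot Gg.
  by exists Y => //; have [_ _ _ tY] := GC _ GY; exact: tY xP.
Qed.

(** In a valuation domain one member [g i] of a finite family divides all the
    others; testing the hypothesis on [y = 1 / g i] shows that [g i] divides
    [x]. *)
Lemma valuation_t_closed (F : fieldType) (V I : set F) : valuation_domain V ->
  is_ideal V I -> t_closed V I.
Proof.
move=> [hV val] hI n g x Ig g0 xP.
suff [i [gi iP]] : exists i, g i != 0 /\ forall j, V (g j / g i).
  rewrite -(divfK gi x); apply: (idealMl hI) => //; rewrite mulrC; apply: xP.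
    exists 1, (g i); rewrite mul1r; split=> //; first exact: subring1.
    exact: (ideal_sub hI).
  by move=> j; rewrite mulrC.
have {Ig} Vg i : V (g i) by exact: (ideal_sub hI).
elim: n g g0 Vg {xP} => [|n IH] g [i gi] Vg; first by case: i gi.
have [[j gj]|nog] := pselect (exists j, g (lift ord0 j) != 0); last first.
  have g0 j : g (lift ord0 j) = 0.
    by apply/eqP/negPn/negP => gj; apply: nog; exists j.
  have gi0 : g ord0 != 0.
    by move: gi; have [j ->|->//] := unliftP ord0 i; rewrite g0 eqxx.
  exists ord0; split=> // j; have [k ->|->] := unliftP ord0 j.
    by rewrite g0 mul0r; exact: subring0.
  by rewrite divff//; exact: subring1.
have [||k [gk kP]] := IH (g \o lift ord0).
- by exists j.
- by move=> ?; exact: Vg.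
have [g0|g0] := eqVneq (g ord0) 0.
  exists (lift ord0 k); split=> // l; have [l' ->|->] := unliftP ord0 l.
    exact: kP.
  by rewrite g0 mul0r; exact: subring0.
have /val : quotient_field V (g ord0 / g (lift ord0 k)).
  by exists (g ord0), (g (lift ord0 k)).
rewrite mulf_neq0 ?invr_eq0// => /(_ isT)[V0|].
  exists (lift ord0 k); split=> // l.
  by have [l' ->|->//] := unliftP ord0 l; exact: kP.
rewrite invfM invrK mulrC => Vk.
exists ord0; split=> // l; have [l' ->|->] := unliftP ord0 l.
  have -> : g (lift ord0 l') / g ord0 =
      (g (lift ord0 l') / g (lift ord0 k)) * (g (lift ord0 k) / g ord0).
    by rewrite mulrA divfK.
  by apply: subringM => //; exact: (kP l').
by rewrite divff//; exact: subring1.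
Qed.

(** * Pullbacks along a residue map *)

(** Domains are subsets of a field, so a surjection onto [K] defined on [V] is
    encoded as a total function [psi] that is constrained on [V] only.  The same
    [psi] can then serve for [T] and for [T_M]. *)
Record residue_hom (F K : fieldType) (V : set F) (psi : F -> K) : Prop := {
  rh_subring : is_subring V;
  rhB : forall x y, V x -> V y -> psi (x - y) = psi x - psi y;
  rhM : forall x y, V x -> V y -> psi (x * y) = psi x * psi y;
  rh1 : psi 1 = 1;
  rh_surj : forall z, exists2 x, V x & psi x = z
}.

(** For a surjection [psi] as above: its kernel is the unique maximal ideal of
    [V], and it is nonzero. *)
Record local_residue (F K : fieldType) (V : set F) (psi : F -> K) : Prop := {
  lr_unit : forall x, V x -> psi x != 0 -> V x^-1;
  lr_ker : exists x, [/\ V x, psi x = 0 & x != 0]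
}.

Definition pullback (F K : fieldType) (V : set F) (psi : F -> K) (E : set K) :
  set F := V `&` psi @^-1` E.

Section LocalResidue.
Variables (F K : fieldType) (V : set F) (psi : F -> K).
Hypothesis h : residue_hom V psi.

Local Notation pb := (pullback V psi).
Local Notation m := (pullback V psi [set 0]).
Let hV := rh_subring h.

Lemma rh0 : psi 0 = 0.
Proof. by rewrite -(subrr 0) (rhB h) ?subrr//; exact: subring0. Qed.

Lemma rhD x y : V x -> V y -> psi (x + y) = psi x + psi y.
Proof.
move=> Vx Vy; have VN : V (- y) by exact: subringN.
have := rhB h (subring0 hV) Vy; rewrite sub0r rh0 sub0r => eN.
by rewrite -[y in LHS]opprK (rhB h)// eN opprK.
Qed.

Lemma rh_sum n (u : 'I_n -> F) : (forall i, V (u i)) ->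
  V (\sum_i u i) /\ psi (\sum_i u i) = \sum_i psi (u i).
Proof.
move=> Vu; elim/big_ind2 : _ => [|x z y t [Vx <-] [Vy <-]|i _]; last by [].
- by split; [exact: subring0|exact: rh0].
- by split; [exact: subringD|exact: rhD].
Qed.

Lemma rh_neq0 x : psi x != 0 -> x != 0.
Proof. by apply: contraNN => /eqP ->; rewrite rh0. Qed.

Hypothesis hl : local_residue V psi.

Lemma rhV x : V x -> psi x != 0 -> psi x^-1 = (psi x)^-1.
Proof.
move=> Vx px; apply: (mulIf px); rewrite mulVf// -(rhM h)//.
  by rewrite mulVf ?rh_neq0// (rh1 h).
exact: (lr_unit hl).
Qed.

Lemma pullbackT : pb setT = V.
Proof. by apply/seteqP; split=> [x []|x]. Qed.

Lemma pullbackS E E' : E `<=` E' -> pb E `<=` pb E'.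
Proof. by move=> EE x [Vx /EE]. Qed.

Lemma image_pullback E : psi @` pb E = E.
Proof.
apply/seteqP; split=> [_ [x [_ Ex] <-]//|z Ez].
by have [x Vx e] := rh_surj h z; exists x => //; split=> //=; rewrite e.
Qed.

Lemma pullback_inj E E' : pb E = pb E' -> E = E'.
Proof. by move=> e; rewrite -(image_pullback E) e image_pullback. Qed.

Lemma pullback_subring E : is_subring (pb E) <-> is_subring E.
Proof.
split=> [hE|hE].
  have lift z : E z -> exists2 x, pb E x & psi x = z.
    move=> Ez; have [x Vx e] := rh_surj h z.
    by exists x => //; split=> //=; rewrite e.
  apply/is_subringP; split.
  - by have [_ /=] := subring1 hE; rewrite (rh1 h).
  - move=> _ _ /lift[x Ax <-] /lift[y Ay <-].
    rewrite -(rhB h); [|by case: Ax|by case: Ay].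
    by have [_] := subringB hE Ax Ay.
  - move=> _ _ /lift[x Ax <-] /lift[y Ay <-].
    rewrite -(rhM h); [|by case: Ax|by case: Ay].
    by have [_] := subringM hE Ax Ay.
apply/is_subringP; split=> [|x y [Vx Ex] [Vy Ey]|x y [Vx Ex] [Vy Ey]].
- by split; [exact: subring1|rewrite /= (rh1 h); exact: subring1].
- by split; [exact: subringB|rewrite /= (rhB h)//; exact: subringB].
- by split; [exact: subringM|rewrite /= (rhM h)//; exact: subringM].
Qed.

Lemma ker_neq0 : m <> [set 0].
Proof.
have [c [Vc c0 cn]] := lr_ker hl => e.
have : m c by []; rewrite e /= => /eqP; exact/negP.
Qed.

Lemma kerMl x c : V x -> m c -> m (x * c).
Proof.
move=> Vx [Vc c0]; split; first exact: subringM.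
by rewrite /= (rhM h)// c0 mulr0.
Qed.

Lemma ker_ideal : is_ideal V m.
Proof.
split; first by move=> x [].
split; first by split; [exact: subring0|exact: rh0].
- move=> x y [Vx x0] [Vy y0]; split; first exact: subringD.
  by rewrite /= rhD// x0 y0 addr0.
- by move=> a x Va; exact: kerMl.
Qed.

Lemma ker_sub_principal x c : V x -> psi x != 0 -> m c ->
  exists2 d, m d & c = d * x.
Proof.
move=> Vx px mc; exists (x^-1 * c).
  by apply: kerMl => //; exact: (lr_unit hl).
by rewrite mulrC mulrA divff ?mul1r ?rh_neq0.
Qed.

Section Ring.
Variable E : set K.
Hypothesis hE : is_subring E.
Let hA : is_subring (pb E). Proof. exact/pullback_subring. Qed.

Lemma ker_sub_pullback (I : set K) : I 0 -> m `<=` pb I.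
Proof. by move=> I0; apply: pullbackS => x ->. Qed.

(** An element outside [m] is a unit of [V], so [m] is contained in every ideal
    that has such an element. *)
Lemma ideal_ker_comparable P : is_ideal (pb E) P -> m `<=` P \/ P `<=` m.
Proof.
move=> hP; have [|/nonsubset[x [Px mx]]] := pselect (P `<=` m); first by right.
left=> c mc; have [Vx Ex] := ideal_sub hP Px.
have px : psi x != 0 by apply/eqP => x0; apply: mx.
have [d md ->] := ker_sub_principal Vx px mc; apply: (idealMl hP) => //.
exact: (ker_sub_pullback (subring0 hE)).
Qed.

Lemma pullback_ideal I : is_ideal E I -> is_ideal (pb E) (pb I).
Proof.
move=> hI; split; first by apply: pullbackS => x; exact: ideal_sub.
split.
- by split; [exact: subring0|rewrite /= rh0; exact: (ideal0 hI)].
- move=> x y [Vx Ix] [Vy Iy]; split; first exact: subringD.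
  by rewrite /= rhD//; exact: (idealD hI).
- move=> a x [Va Ea] [Vx Ix]; split; first exact: subringM.
  by rewrite /= (rhM h)//; exact: (idealMl hI).
Qed.

Lemma image_ideal P : is_ideal (pb E) P -> is_ideal E (psi @` P).
Proof.
move=> hP; split; first by move=> _ [x /(ideal_sub hP)[_ ?] <-].
split.
- by exists 0; [exact: ideal0 hP|exact: rh0].
- move=> _ _ [x Px <-] [y Py <-]; exists (x + y); first exact: (idealD hP).
  by rewrite rhD//; [case: (ideal_sub hP Px)|case: (ideal_sub hP Py)].
- move=> a _ Ea [x Px <-]; have [b Vb eb] := rh_surj h a.
  exists (b * x); last by rewrite (rhM h) ?eb//; case: (ideal_sub hP Px).
  by apply: (idealMl hP) => //; split=> //=; rewrite eb.
Qed.

(** The correspondence theorem for ideals above the kernel. *)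
Lemma pullback_image P : is_ideal (pb E) P -> m `<=` P -> pb (psi @` P) = P.
Proof.
move=> hP mP; apply/seteqP; split=> [x [Vx [y Py e]]|x Px]; last first.
  by split; [case: (ideal_sub hP Px)|exists x].
have Vy : V y by case: (ideal_sub hP Py).
rewrite -(subrK y x); apply: (idealD hP) => //; apply: mP.
by split; [exact: subringB|rewrite /= (rhB h)// e subrr].
Qed.

Lemma pullback_unit (I : set K) : pb I 1 <-> I 1.
Proof.
split=> [[_]|I1]; first by rewrite /= (rh1 h).
by split; [exact: subring1|rewrite /= (rh1 h)].
Qed.

Lemma pullback_prime q : prime_ideal E q -> prime_ideal (pb E) (pb q).
Proof.
move=> [hq q1 qp]; split; [exact: pullback_ideal|by move=> /pullback_unit|].
move=> x y [Vx Ex] [Vy Ey] [_]; rewrite /= (rhM h)// => /qp[]//.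
  by left.
by right.
Qed.

Lemma image_prime P : prime_ideal (pb E) P -> m `<=` P ->
  prime_ideal E (psi @` P).
Proof.
move=> [hP P1 Pp] mP; have eP := pullback_image hP mP; split.
- exact: image_ideal.
- by move=> /pullback_unit; rewrite eP.
- move=> a b; have [x Vx <-] := rh_surj h a; have [y Vy <-] := rh_surj h b.
  move=> Ex Ey Pxy.
  have : P (x * y).
    by rewrite -eP; split; [exact: subringM|rewrite /= (rhM h)].
  by move=> /Pp[]// ?; [left; exists x|right; exists y].
Qed.

Lemma pullback_localization q : q 0 ->
  localization (pb E) (pb q) = pb (localization E q).
Proof.
move=> q0; apply/seteqP; split=> x.
  move=> [a [s [[Va Ea] [Vs Es] qs ->]]].
  have {}qs : ~ q (psi s) by move=> ?; apply: qs.
  have s0 : psi s != 0 by apply/eqP => s0; apply: qs; rewrite s0.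
  have Vi := lr_unit hl Vs s0.
  split; first exact: subringM.
  by exists (psi a), (psi s); rewrite (rhM h)// rhV.
move=> [Vx [a [b [Ea Eb qb e]]]].
have [s Vs es] := rh_surj h b; rewrite -es in Eb qb e.
have s0 : psi s != 0 by apply/eqP => s0; apply: qb; rewrite s0.
exists (x * s), s; split=> //.
- split; first exact: subringM.
  by rewrite /= (rhM h)// e divfK.
- by move=> [].
- by rewrite mulfK// rh_neq0.
Qed.

(** A nonzero element of [m] is a conductor of [V] into the pullback. *)
Lemma quotient_field_pullback : V `<=` quotient_field (pb E).
Proof.
move=> x Vx; have [c [Vc c0 cn]] := lr_ker hl.
have mE := @ker_sub_pullback E (subring0 hE).
exists (x * c), c; split=> //; last by rewrite mulfK.
  by apply: mE; apply: kerMl.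
exact: mE.
Qed.

Lemma quotient_field_pullbackE : quotient_field (pb E) = quotient_field V.
Proof.
apply/seteqP; split; first by apply: quotient_fieldS => x [].
by move=> x /(quotient_fieldS quotient_field_pullback)/(quotient_field_idem hA).
Qed.

(** Elements of [m] are in the pullback, and for a unit [x] of [V] whether [x]
    or its inverse is in the pullback is decided by [psi x] in [E]; units reach
    every nonzero element of [K], whence the condition on the quotient field. *)
Lemma pullback_valuation : valuation_domain (pb E) <->
  [/\ valuation_domain E, valuation_domain V & quotient_field E = setT].
Proof.
split=> [[_ val]|[[_ valE] [_ valV] qE]].
  have key z : z != 0 -> E z \/ E z^-1.
    have [x Vx <-] := rh_surj h z => px.
    have /val/(_ (rh_neq0 px)) := quotient_field_pullback Vx.
    by move=> [[]|[_]]; [left|right; rewrite -rhV].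
  split.
  - by split=> // z _; exact: key.
  - by apply: (valuation_overring (A := pb E)) => // [x []//|];
      exact: quotient_field_pullback.
  - apply/seteqP; split=> // z _.
    have [->|z0] := eqVneq z 0.
      by apply: sub_quotient_field => //; exact: subring0.
    have [|Ez] := key _ z0; first exact: sub_quotient_field.
    exists 1, z^-1; rewrite invr_eq0 mul1r invrK; split=> //.
    exact: subring1.
have half x : V x -> pb E x \/ pb E x^-1.
  move=> Vx; have [x0|px] := eqVneq (psi x) 0.
    by left; apply: (ker_sub_pullback (subring0 hE)).
  have /valE/(_ px)[Ex|Ex] : quotient_field E (psi x) by rewrite qE.
    by left.
  by right; split; [exact: (lr_unit hl)|rewrite /= rhV].
split=> // x; rewrite quotient_field_pullbackE => /valV val /val[/half//|/half].
by rewrite invrK => -[]; [right|left].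
Qed.

(** If [c] is in [m] but not in [Q], then [c v] is in the pullback for every [v]
    in [V], and [c (v x) = (c v) x] shows that [Q] absorbs [V]. *)
Lemma prime_below_ker Q : prime_ideal (pb E) Q -> Q `<=` m -> prime_ideal V Q.
Proof.
move=> [hQ Q1 Qp] Qm.
have mE := @ker_sub_pullback E (subring0 hE).
have [Qe|/nonsubset[c [mc Qc]]] := pselect (m `<=` Q).
  have -> : Q = m by apply/seteqP.
  split; [exact: ker_ideal|by move=> [_ /eqP]; rewrite (rh1 h) oner_eq0|].
  move=> x y Vx Vy [_]; rewrite /= (rhM h)// => /eqP; rewrite mulf_eq0.
  by move=> /orP[]/eqP; [left|right].
have VQ v x : V v -> Q x -> Q (v * x).
  move=> Vv Qx.
  have : Q (c * (v * x)).
    by rewrite mulrA [c * v]mulrC; apply: (idealMl hQ) => //; exact/mE/kerMl.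
  have Avx : pb E (v * x) by apply/mE/kerMl => //; exact: Qm.
  by move=> /(Qp _ _ (mE _ mc) Avx)[].
split=> //.
  split; first by move=> x /Qm[].
  by split=> //; [exact: ideal0 hQ|move=> x y; exact: (idealD hQ)].
move=> x y Vx Vy Qxy.
have [x0|px] := eqVneq (psi x) 0; last first.
  right; rewrite -(mulKf (rh_neq0 px) y); apply: VQ => //.
  exact: (lr_unit hl).
have [y0|py] := eqVneq (psi y) 0; last first.
  left; rewrite -(mulfK (rh_neq0 py) x) mulrC; apply: VQ => //.
  exact: (lr_unit hl).
by apply: Qp => //; apply: mE.
Qed.

Lemma exists_notin_ker (I : set K) : I <> [set 0] -> I 0 ->
  exists2 x, pb I x & psi x != 0.
Proof.
move=> In0 I0; apply: contrapT => nx; apply: In0.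
apply/seteqP; split=> [z Iz|z ->//] /=.
have [x Vx e] := rh_surj h z; apply/eqP/negPn/negP => z0; apply: nx.
by exists x; [split=> //=; rewrite e|rewrite e].
Qed.

Lemma pullback_neq0 (I : set K) : I 0 -> pb I <> [set 0].
Proof.
move=> I0 e; apply: ker_neq0; apply/seteqP; split; last first.
  by move=> x ->; split; [exact: subring0|exact: rh0].
by rewrite -e; exact: ker_sub_pullback.
Qed.

(** Lifting a sum of products gives the result up to an element of [m], and
    this is a multiple of any [c] of the pullback of [I] outside [m], with
    cofactor in [m]. *)
Lemma pullback_mul (I : set K) : is_ideal E I -> I <> [set 0] ->
  ideal_mul (pb I) (pb I) = pb (ideal_mul I I).
Proof.
move=> hI In0; apply/seteqP; split=> x.
  move=> [n [u [v [Iu Iv ->]]]].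
  have Vu i : V (u i) by case: (Iu i).
  have Vv i : V (v i) by case: (Iv i).
  have [|Vs es] := @rh_sum n (fun i => u i * v i).
    by move=> i; exact: subringM.
  split=> //; exists n, (psi \o u), (psi \o v); split=> [i|i|].
  - by case: (Iu i).
  - by case: (Iv i).
  - by rewrite es; apply: eq_bigr => i _; rewrite (rhM h).
move=> [Vx [n [a [b [Ia Ib e]]]]].
have /choice[s sP] z : exists x, V x /\ psi x = z.
  by have [y Vy <-] := rh_surj h z; exists y.
have [c [Vc Ic] cn] := exists_notin_ker In0 (ideal0 hI).
have [|Vs es] := @rh_sum n (fun i => s (a i) * s (b i)).
  by move=> i; apply: subringM => //; case: (sP (a i)) (sP (b i)) => ? _ [].
have mr : m (x - \sum_i s (a i) * s (b i)).
  split; first exact: subringB.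
  rewrite /= (rhB h)// es e; apply/eqP; rewrite subr_eq0; apply/eqP.
  apply: eq_bigr => i _; have [? ea] := sP (a i); have [? eb] := sP (b i).
  by rewrite (rhM h)// ea eb.
have [d md ed] := ker_sub_principal Vc cn mr.
exists n.+1, (fun i => if unlift ord0 i is Some j then s (a j) else d),
  (fun i => if unlift ord0 i is Some j then s (b j) else c); split=> [i|i|].
- case: unliftP => [j _|_].
    by have [? ea] := sP (a j); split=> //=; rewrite ea.
  exact: (ker_sub_pullback (ideal0 hI)).
- case: unliftP => [j _|_]; last by [].
  by have [? ea] := sP (b j); split=> //=; rewrite ea.
- rewrite big_ord_recl unlift_none (eq_bigr (fun i => s (a i) * s (b i))).
    by rewrite -ed subrK.
  by move=> i _; rewrite !liftK.
Qed.

Lemma pullback_strongly_discrete_inv :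
  strongly_discrete (pb E) -> strongly_discrete E.
Proof.
move=> sd [q [qpr q0 qq]]; apply: sd; exists (pb q).
have hq := prime_is_ideal qpr; split; first exact: pullback_prime.
- exact: (pullback_neq0 (ideal0 hq)).
- by rewrite pullback_mul// -qq.
Qed.

(** An idempotent prime lies below [m], and is then an idempotent prime of [V],
    or above it, and then comes from an idempotent prime of [E]. *)
Lemma pullback_strongly_discrete :
  strongly_discrete E -> strongly_discrete V -> strongly_discrete (pb E).
Proof.
move=> sdE sdV [P [Ppr P0 PP]]; have hP := prime_is_ideal Ppr.
have [Pm|Pm] := pselect (P `<=` m).
  by apply: sdV; exists P; split=> //; exact: prime_below_ker.
have [mP|//] := ideal_ker_comparable hP.
have eP := pullback_image hP mP.
have I0 : psi @` P <> [set 0].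
  by move=> e; apply: Pm; rewrite -eP e.
apply: sdE; exists (psi @` P); split=> //; first exact: image_prime.
apply: pullback_inj; rewrite -pullback_mul//; last exact: image_ideal.
by rewrite eP.
Qed.

Lemma ker_pullback_ideal : is_ideal (pb E) m.
Proof. by apply: pullback_ideal; case: (prime_zero hE). Qed.

Lemma ker_not_unit : ~ m 1.
Proof. by move=> [_ /=]; rewrite (rh1 h) => /eqP; rewrite oner_eq0. Qed.

(** * t-ideals of a pullback *)

Section Proper.
Hypothesis E_proper : E <> setT.

(** Every [v] in [V] multiplies [m] into the pullback; if [x] is in the
    t-closure of [m], then [V x] is in the pullback, so [E] contains all
    multiples of [psi x] in [K], and [psi x = 0]. *)
Lemma ker_t_closed : t_closed (pb E) m.
Proof.
move=> n g x mg g0 xP.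
have AQ y : V y -> pb E (y * x).
  move=> Vy; apply: xP; first exact: quotient_field_pullback.
  by move=> i; apply: (ker_sub_pullback (subring0 hE)); exact: kerMl.
have [Vx Ex] : pb E x by rewrite -[x]mul1r; apply: AQ; exact: subring1.
split=> //=; apply/eqP/negPn/negP => x0; apply: E_proper.
apply/seteqP; split=> // z _.
have [v Vv ev] := rh_surj h (z / psi x).
have [_] := AQ _ Vv; rewrite /= (rhM h)// ev divfK//.
Qed.

Lemma ker_proper_t : proper_t_ideal (pb E) m.
Proof.
apply/proper_t_idealP => //; split; [exact: ker_pullback_ideal| | |].
- exact: ker_not_unit.
- exact: ker_neq0.
- exact: ker_t_closed.
Qed.

(** A maximal t-ideal is comparable with the t-ideal [m], hence contains it. *)
Lemma maximal_t_above_ker N : maximal_t_ideal (pb E) N -> m `<=` N.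
Proof.
move=> [tN Nmax]; have [hN _ _ _] := (proper_t_idealP _ hA).1 tN.
have [//|Nm] := ideal_ker_comparable hN.
by rewrite (Nmax _ ker_proper_t Nm).
Qed.

Section QuotientField.
Hypothesis qE : quotient_field E = setT.

(** A family that is not contained in [m] contains a unit of [V], so only
    multipliers [y] in [V] matter and they can be read in [K].  A family in [m]
    is dealt with by [ker_t_closed]. *)
Lemma t_closed_pullback I : is_ideal E I -> I <> [set 0] ->
  t_closed (pb E) (pb I) <-> t_closed E I.
Proof.
move=> hI I0; split=> tI.
  move=> n g w Ig [j gj] wP.
  have /choice[s sP] z : exists x, V x /\ psi x = z.
    by have [y Vy <-] := rh_surj h z; exists y.
  have [Vw ew] := sP w.
  suff : pb I (s w) by case=> _ /=; rewrite ew.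
  apply: (tI n (s \o g)) => [i| |y Qy yP].
  - by have [? e] := sP (g i); split=> //=; rewrite e.
  - by exists j; have [? e] := sP (g j); apply: rh_neq0; rewrite /= e.
  - have [Vj ej] := sP (g j).
    have Vy : V y.
      rewrite -(mulfK (rh_neq0 _ : s (g j) != 0) y) ?ej//.
      apply: subringM => //; first by case: (yP j).
      by apply: (lr_unit hl) => //; rewrite ej.
    split; first exact: subringM.
    rewrite /= (rhM h)// ew; apply: wP; first by rewrite qE.
    move=> i; have [Vi ei] := sP (g i).
    by have [_] := yP i; rewrite /= (rhM h)// ei.
move=> n g x Ig g0 xP.
have Vg i : V (g i) by case: (Ig i).
have [[j gj]|gm] := pselect (exists j, psi (g j) != 0); last first.
  apply: (ker_sub_pullback (ideal0 hI)).
  apply: (ker_t_closed (g := g)) => // i; split=> //=.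
  by apply/eqP/negPn/negP => gi; apply: gm; exists i.
have [Vx Ex] : pb E x.
  rewrite -[x]mul1r; apply: xP.
    by apply: quotient_field_pullback; exact: subring1.
  move=> i; rewrite mul1r; split=> //.
  by apply: (ideal_sub hI); case: (Ig i).
split=> //=; apply: (tI n (psi \o g)) => [i| |z _ zP].
- by case: (Ig i).
- by exists j.
- have [y Vy ey] := rh_surj h z.
  have [|i|_] := xP y; first exact: quotient_field_pullback.
    by split; [exact: subringM|rewrite /= (rhM h)// ey; exact: zP].
  by rewrite /= (rhM h)// ey.
Qed.

Lemma proper_t_pullback I : is_ideal E I -> I <> [set 0] ->
  proper_t_ideal (pb E) (pb I) <-> proper_t_ideal E I.
Proof.
move=> hI I0; split.
  move=> /(proper_t_idealP _ hA)[_ I1 _ tI]; apply/proper_t_idealP => //.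
  by split=> //; [move=> /pullback_unit|exact/t_closed_pullback].
move=> /(proper_t_idealP _ hE)[_ I1 _ tI]; apply/proper_t_idealP => //.
split; first exact: pullback_ideal.
- by move=> /pullback_unit.
- exact: (pullback_neq0 (ideal0 hI)).
- exact/t_closed_pullback.
Qed.

Lemma maximal_t_pullback I : is_ideal E I -> I <> [set 0] ->
  maximal_t_ideal (pb E) (pb I) <-> maximal_t_ideal E I.
Proof.
move=> hI I0; split=> -[tI Imax]; split.
- exact/proper_t_pullback.
- move=> J tJ IJ; have [hJ _ J0 _] := (proper_t_idealP _ hE).1 tJ.
  apply: pullback_inj; apply: Imax; last exact: pullbackS.
  exact/proper_t_pullback.
- exact/proper_t_pullback.
- move=> J tJ IJ; have [hJ _ J0 _] := (proper_t_idealP _ hA).1 tJ.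
  have mJ : m `<=` J.
    by apply: subset_trans IJ; exact: (ker_sub_pullback (ideal0 hI)).
  have eJ := pullback_image hJ mJ; rewrite -eJ; congr pullback.
  have IpJ : I `<=` psi @` J by rewrite -[I]image_pullback; exact: image_subset.
  apply: Imax => //; apply/proper_t_pullback; last by rewrite eJ.
    exact: image_ideal.
  move=> e; apply: I0; apply/seteqP; split; first by rewrite -e.
  by move=> x ->; exact: (ideal0 hI).
Qed.

End QuotientField.
End Proper.

End Ring.

(** * GK-domains and local pullbacks *)

(** Localizing at a maximal t-ideal [N] above [m] gives the pullback of the
    localization of [E] at [psi N], to which [pullback_valuation] applies. *)
Lemma GK_pullback_valuation E : is_subring E -> E <> setT ->
  GK_domain (pb E) -> valuation_domain V /\ quotient_field E = setT.
Proof.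
move=> hE En [hA gk _].
have [N maxN mN] := exists_maximal_t hA (ker_proper_t hE En).
have [hN _ _ _] := (proper_t_idealP _ hA).1 maxN.1.
have hI := image_ideal hN.
have := (gk _ maxN).1; rewrite -(pullback_image hN mN).
rewrite pullback_localization; last exact: ideal0 hI.
move=> val; have hL := (pullback_subring _).1 val.1.
have [_ valV qL] := (pullback_valuation hL).1 val; split=> //.
apply/seteqP; split=> // z _; apply: (quotient_field_idem hE).
have : quotient_field (localization E (psi @` N)) z by rewrite qL.
by apply/quotient_fieldS/localization_quotient_field => //; exact: ideal0 hI.
Qed.

(** All ideals of a valuation domain are t-closed, so [m] is a maximal t-ideal,
    and localizing at [m] does not change [V]. *)
Lemma GK_valuation_strongly_discrete : GK_domain V -> valuation_domain V ->
  strongly_discrete V.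
Proof.
move=> [_ gk _] val; have maxm : maximal_t_ideal V m.
  split.
    apply/proper_t_idealP => //; split; [exact: ker_ideal| | |].
    - exact: ker_not_unit.
    - exact: ker_neq0.
    - by apply: valuation_t_closed => //; exact: ker_ideal.
  move=> J /(proper_t_idealP _ hV)[hJ J1 _ _] mJ; apply/seteqP; split=> // x Jx.
  have Vx := ideal_sub hJ Jx; split=> //; apply/eqP/negPn/negP => px; apply: J1.
  rewrite -(mulVf (rh_neq0 px)); apply: (idealMl hJ) => //; exact: (lr_unit hl).
have [_] := gk _ maxm.
suff -> : localization V m = V by [].
apply/seteqP; split; last exact/sub_localization/ker_not_unit.
move=> x [a [s [Va Vs ms ->]]]; apply: subringM => //.
apply: (lr_unit hl) => //.
by apply/eqP => s0; apply: ms.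
Qed.

(** A prime containing [a] is not contained in [m], hence contains [m]. *)
Lemma minimal_prime_pullback E a : is_subring E -> pb E a -> psi a != 0 ->
  [set P | minimal_prime (pb E) (principal_ideal (pb E) a) P] =
  pb @` [set q | minimal_prime E (principal_ideal E (psi a)) q].
Proof.
move=> hE Aa pa; have hA := (pullback_subring E).2 hE.
have above P : is_ideal (pb E) P -> P a -> m `<=` P.
  move=> hP Pa; have [//|/(_ _ Pa)[_ a0]] := ideal_ker_comparable hE hP.
  by move: pa; rewrite a0 eqxx.
have Ea : E (psi a) by case: Aa.
apply/seteqP; split=> [P [Ppr aP Pmin]|_ [q [qpr aq qmin] <-]].
  have hP := prime_is_ideal Ppr.
  have Pa := (principal_ideal_sub hA _ hP).1 aP.
  have mP := above _ hP Pa; have eP := pullback_image hP mP.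
  have prI := image_prime Ppr mP.
  exists (psi @` P) => //; split=> //.
    by apply/(principal_ideal_sub hE _ (prime_is_ideal prI)); exists a.
  move=> Q Qpr Qa QI; apply: pullback_inj; rewrite eP; apply: Pmin.
  - exact: pullback_prime.
  - apply/principal_ideal_sub => //; first exact/pullback_ideal/prime_is_ideal.
    split; first by case: Aa.
    by apply/(principal_ideal_sub hE _ (prime_is_ideal Qpr)).
  - by rewrite -eP; exact: pullbackS.
have hq := prime_is_ideal qpr.
have qa := (principal_ideal_sub hE _ hq).1 aq.
split; first exact: pullback_prime.
  apply/principal_ideal_sub => //; first exact: pullback_ideal.
  by split=> //; case: Aa.
move=> Q Qpr aQ Qq; have hQ := prime_is_ideal Qpr.
have Qa := (principal_ideal_sub hA _ hQ).1 aQ.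
have mQ := above _ hQ Qa; have eQ := pullback_image hQ mQ.
rewrite -eQ; congr pullback; apply: qmin.
- exact: image_prime.
- by apply/(principal_ideal_sub hE _ (image_ideal hQ)); exists a.
- by rewrite -[q]image_pullback; exact: image_subset.
Qed.

(** A maximal t-ideal of the pullback is either [m], where the localization is
    [V] because [K] is the quotient field of [E], or it comes from a maximal
    t-ideal of [E].  An [a] in [m] has at most one minimal prime, as these lie
    below [m] and are primes of the valuation domain [V]. *)
Lemma GK_pullback E : is_subring E -> E <> setT -> quotient_field E = setT ->
  valuation_domain V -> GK_domain E -> GK_domain V -> GK_domain (pb E).
Proof.
move=> hE En qE val [_ gkE finE] gkV; have hA := (pullback_subring E).2 hE.
have sdV := GK_valuation_strongly_discrete gkV val.
split=> // [N maxN|a Aa].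
  have mN := maximal_t_above_ker hE En maxN.
  have [hN _ _ _] := (proper_t_idealP _ hA).1 maxN.1.
  have hI := image_ideal hN.
  have eN := pullback_image hN mN; rewrite -eN.
  rewrite pullback_localization; last exact: ideal0 hI.
  have [I0|I0] := pselect (psi @` N = [set 0]).
    by rewrite I0 quotient_field_zero qE pullbackT.
  have maxI : maximal_t_ideal E (psi @` N).
    by apply/(maximal_t_pullback hE En qE hI I0); rewrite eN.
  have [valI sdI] := gkE _ maxI.
  split; last exact: (pullback_strongly_discrete valI.1).
  apply/(pullback_valuation valI.1); split=> //.
  apply/seteqP; split=> // z _.
  have : quotient_field E z by rewrite qE.
  apply/quotient_fieldS/sub_localization => //.
  have [_ N1 _ _] := (proper_t_idealP _ hA).1 maxN.1.
  by move=> /pullback_unit; rewrite eN.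
have [a0|pa] := eqVneq (psi a) 0; last first.
  by rewrite minimal_prime_pullback//; apply/finite_image/finE; case: Aa.
have Pm P : minimal_prime (pb E) (principal_ideal (pb E) a) P -> P `<=` m.
  move=> [Ppr aP Pmin].
  have [mP|//] := ideal_ker_comparable hE (prime_is_ideal Ppr).
  suff -> : m = P by [].
  apply: Pmin => //; first exact/pullback_prime/prime_zero.
  apply/principal_ideal_sub => //; first exact: ker_pullback_ideal.
  by split=> //; case: Aa.
have [[P0 P0min]|none] := pselect (exists P,
    minimal_prime (pb E) (principal_ideal (pb E) a) P); last first.
  by apply: (sub_finite_set (B := set0)) => // P ?; apply: none; exists P.
apply: (sub_finite_set (B := [set P0])); last exact: finite_set1.
move=> P Pmin /=.
have [Ppr aP Pmin'] := Pmin; have [P0pr aP0 P0min'] := P0min.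
have VP := prime_is_ideal (prime_below_ker hE Ppr (Pm _ Pmin)).
have VP0 := prime_is_ideal (prime_below_ker hE P0pr (Pm _ P0min)).
have [PP|PP] := valuation_comparable val VP VP0; first exact: P0min'.
by apply/esym; apply: Pmin'.
Qed.

Lemma GK_residue_of_pullback E : is_subring E -> E <> setT ->
  quotient_field E = setT -> GK_domain (pb E) -> GK_domain E.
Proof.
move=> hE En qE [hA gk fin]; split=> // [N maxN|e Ee].
  have [hN _ N0 _] := (proper_t_idealP _ hE).1 maxN.1.
  have := gk _ ((maximal_t_pullback hE En qE hN N0).2 maxN).
  rewrite pullback_localization; last exact: ideal0 hN.
  move=> [valL sdL]; have hL := (pullback_subring _).1 valL.1.
  split; first by case/(pullback_valuation hL): valL.
  exact: pullback_strongly_discrete_inv.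
have [->|e0] := eqVneq e 0.
  apply: (sub_finite_set (B := [set [set 0]])); last exact: finite_set1.
  move=> P [Ppr _ Pmin] /=; apply/esym; apply: Pmin; first exact: prime_zero.
    by move=> _ [x _ <-]; rewrite mul0r.
  by move=> x ->; exact: (ideal0 (prime_is_ideal Ppr)).
have [a Va ea] := rh_surj h e.
have Aa : pb E a by split=> //=; rewrite ea.
have := fin _ Aa; rewrite minimal_prime_pullback//; rewrite ea//.
move=> /(finite_image (fun P => psi @` P)); rewrite image_comp.
rewrite (_ : _ \o _ = id) ?image_id//.
by apply/funext => q /=; exact: image_pullback.
Qed.

End LocalResidue.

Lemma GK_field (K : fieldType) : GK_domain [set: K].
Proof.
have hT : is_subring [set: K] by apply/is_subringP.
have idl (I : set K) : is_ideal setT I -> I <> [set 0] -> I 1.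
  move=> hI I0; apply: contrapT => I1; apply: I0; apply/seteqP; split=> x /=.
    move=> Ix; apply/eqP/negPn/negP => x0; apply: I1.
    by rewrite -(mulVf x0); exact: (idealMl hI).
  by move=> ->; exact: (ideal0 hI).
split=> // [N [/(proper_t_idealP _ hT)[hN N1 N0 _] _]|a _].
  by case: N1; exact: idl.
apply: (sub_finite_set (B := [set [set 0]])); last exact: finite_set1.
move=> P [[hP P1 _] _ _] /=; apply: contrapT => P0; apply: P1; exact: idl.
Qed.

(** * Localizations of the global pullback *)

Lemma quotient_field_localization (F : fieldType) (A P : set F) :
  is_subring A -> P 0 -> ~ P 1 ->
  quotient_field (localization A P) = quotient_field A.
Proof.
move=> hA P0 P1; apply/seteqP; split; last first.
  exact/quotient_fieldS/sub_localization.
move=> x /(quotient_fieldS (localization_quotient_field P0)).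
exact: quotient_field_idem.
Qed.

(** For [x] outside [D], the [d] in [D] with [d x] in [D] form a proper ideal;
    if [x] were in the localization at a prime [p] above it, a denominator of
    [x] would be such a [d] outside [p]. *)
Lemma exists_prime_localization_neqT (K : fieldType) (D : set K) :
  is_subring D -> D <> setT ->
  exists2 p, prime_ideal D p & localization D p <> setT.
Proof.
move=> hD Dn.
have [x Dx] : exists x, ~ D x.
  by apply: contrapT => nx; apply: Dn; apply/seteqP; split=> // x _;
    apply: contrapT => Dx; apply: nx; exists x.
pose J := [set d | D d /\ D (d * x)].
have [||p ppr Jp] := @exists_prime_above _ D J hD.
- split; first by move=> d [].
  split; first by rewrite /J /= mul0r; split; exact: subring0.
  - move=> a b [Da Dax] [Db Dbx]; split; first exact: subringD.
    by rewrite mulrDl; exact: subringD.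
  - move=> a b Da [Db Dbx]; split; first exact: subringM.
    by rewrite -mulrA; exact: subringM.
- by move=> [_]; rewrite mul1r.
exists p => // pT; have [a [s [Da Ds ps e]]] : localization D p x by rewrite pT.
have s0 : s != 0.
  apply/eqP => s0; apply: ps; rewrite s0.
  exact: (ideal0 (prime_is_ideal ppr)).
by apply: ps; apply: Jp; split=> //; rewrite e mulrC divfK.
Qed.

Section Global.
Variables (F K : fieldType) (T V : set F) (psi : F -> K) (D : set K).
Hypotheses (hV : residue_hom V psi) (lV : local_residue V psi).
Hypotheses (hT : residue_hom T psi) (TV : T `<=` V).
Hypothesis VT : forall x, V x ->
  exists t u, [/\ T t, T u, psi u != 0 & x = t / u].
Hypothesis hD : is_subring D.

Local Notation M := (pullback T psi [set 0]).
Local Notation R := (pullback T psi D).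
Let Tr := rh_subring hT.
Let hR : is_subring R. Proof. exact/(pullback_subring hT). Qed.
Let MR : M `<=` R.
Proof. by apply: pullbackS => x ->; exact: subring0. Qed.

Lemma localization_ker : localization T M = V.
Proof.
apply/seteqP; split=> [x [a [s [Ta Ts Ms ->]]]|x /VT[t [u [Tt Tu pu ->]]]].
  apply: (subringM (rh_subring hV)); first exact: TV.
  apply: (lr_unit lV); first exact: TV.
  by apply/eqP => s0; apply: Ms.
by exists t, u; split=> // -[_ /eqP]; exact/negP.
Qed.

Lemma localization_pullback_above p : prime_ideal D p ->
  localization R (pullback T psi p) = pullback V psi (localization D p).
Proof.
move=> ppr; have hp := prime_is_ideal ppr.
have p0 z : ~ p z -> z != 0.
  by move=> pz; apply/eqP => z0; apply: pz; rewrite z0; exact: (ideal0 hp).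
apply/seteqP; split=> x.
  move=> [a [s [[Ta Da] [Ts Ds] qs ->]]].
  have {}qs : ~ p (psi s) by move=> ?; apply: qs.
  have Va := TV Ta; have Vs := TV Ts.
  have Vi := lr_unit lV Vs (p0 _ qs).
  split; first exact: (subringM (rh_subring hV)).
  by exists (psi a), (psi s); rewrite (rhM hV)// (rhV hV lV)//; exact: p0.
move=> [Vx [a [b [Da Db pb e]]]].
have [t [u [Tt Tu pu ex]]] := VT Vx.
have [s Ts es] := rh_surj hT b; rewrite -es in Db pb e.
have [w Tw ew] := rh_surj hT (psi u)^-1.
have uw1 : psi (u * w) = 1 by rewrite (rhM hT)// ew mulfV.
have suw : psi (s * (u * w)) = psi s.
  by rewrite (rhM hT)//; [rewrite uw1 mulr1|exact: subringM].
have w0 : w != 0 by apply: (rh_neq0 hT); rewrite ew invr_eq0.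
have u0 : u != 0 by exact: (rh_neq0 hT).
have s0 : s != 0 by apply: (rh_neq0 hT); exact: p0.
(* [u] is invertible modulo [M] only, so [u * w] replaces it: it has residue
   [1] and hence lies in [R], outside the prime. *)
have num : x * (s * (u * w)) = s * t * w.
  rewrite ex !mulrA [t / u * s]mulrC mulrA -[s * t / u * u]mulrA.
  by rewrite mulVf// mulr1.
have Tsuw : T (s * (u * w)) by do 2 apply: subringM => //.
exists (x * (s * (u * w))), (s * (u * w)); split.
- split; first by rewrite num; do 2 apply: subringM => //.
  by rewrite /= (rhM hV) ?suw ?e ?divfK ?p0//; exact: TV.
- by split=> //=; rewrite suw.
- by move=> [_]; rewrite /= suw.
- by rewrite mulfK// !mulf_neq0.
Qed.

(** [c] multiplies [T] into [R], so [t / u = c t / c u] has both terms in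
    [R]. *)
Lemma localization_pullback_away Q c : prime_ideal T Q -> M c -> ~ Q c ->
  localization R (R `&` Q) = localization T Q.
Proof.
move=> Qpr Mc Qc; apply/seteqP; split=> x.
  move=> [a [s [Ra Rs Qs ->]]]; exists a, s; split=> //.
  - by case: Ra.
  - by case: Rs.
  - by move=> ?; apply: Qs.
have [Tc _] := Mc.
have cR z : T z -> R (c * z).
  by move=> Tz; apply: MR; rewrite mulrC; apply: (kerMl hT).
move=> [a [s [Ta Ts Qs ->]]]; exists (c * a), (c * s); split.
- exact: cR.
- exact: cR.
- by move=> [_]; exact: (prime_mul Qpr).
- rewrite -mulf_div divff ?mul1r//; apply/eqP => c0; apply: Qc; rewrite c0.
  exact: (ideal0 (prime_is_ideal Qpr)).
Qed.

Lemma prime_trace Q : prime_ideal T Q -> prime_ideal R (R `&` Q).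
Proof.
move=> Qpr; have hQ := prime_is_ideal Qpr; case: Qpr => _ Q1 Qp.
split; last 2 first.
- by case.
- move=> x y Rx Ry [_ /Qp]; case: (Rx) (Ry) => Tx _ [Ty _] /(_ Tx Ty)[].
    by left.
  by right.
split; first by move=> x [].
split.
- by split; [exact: subring0|exact: (ideal0 hQ)].
- by move=> x y [Rx Qx] [Ry Qy]; split; [exact: subringD|exact: (idealD hQ)].
- move=> a x Ra [Rx Qx]; split; first exact: subringM.
  by apply: (idealMl hQ) => //; case: Ra.
Qed.

(** Take for [Q] the [x] in [T] with [c x] in [P]; the factor [c] brings all
    products back into [R], where [P] is prime. *)
Lemma prime_extend P c : prime_ideal R P -> M c -> ~ P c ->
  exists Q, [/\ prime_ideal T Q, ~ Q c & R `&` Q = P].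
Proof.
move=> Ppr Mc Pc; have hP := prime_is_ideal Ppr; have [_ P1 Pp] := Ppr.
have Rc := MR Mc; have [Tc _] := Mc.
have cR z : T z -> R (c * z).
  by move=> Tz; apply: MR; rewrite mulrC; apply: (kerMl hT).
exists [set x | T x /\ P (c * x)]; split; last 1 first.
- apply/seteqP; split=> [x [Rx [_]]|x Px]; first by move=> /(Pp _ _ Rc Rx)[].
  have [Tx Dx] := ideal_sub hP Px; split=> //; split=> //.
  exact: (idealMl hP).
- split.
  + split; first by move=> x [].
    split.
    * by rewrite /= mulr0; split; [exact: subring0|exact: (ideal0 hP)].
    * move=> x y [Tx Px] [Ty Py]; split; first exact: subringD.
      by rewrite mulrDr; exact: (idealD hP).
    * move=> a x Ta [Tx Px]; have Tax : T (a * x) by exact: subringM.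
      split=> //; have : P (c * (c * (a * x))).
        have -> : c * (c * (a * x)) = (c * a) * (c * x).
          by rewrite -mulrA [a * (c * x)]mulrCA.
        by apply: (idealMl hP) => //; exact: cR.
      by move=> /(Pp _ _ Rc (cR _ Tax))[].
  + by rewrite /= mulr1 => -[].
  + move=> x y Tx Ty [_ Pxy].
    have : P ((c * x) * (c * y)).
      have -> : c * x * (c * y) = c * (c * (x * y)) by rewrite mulrACA -mulrA.
      exact: (idealMl hP).
    by move=> /(Pp _ _ (cR _ Tx) (cR _ Ty))[]; [left|right].
- by move=> [_ /(Pp _ _ Rc Rc)[]].
Qed.

(** [M] is maximal: outside [M] every element has an inverse modulo [M]. *)
Lemma prime_above_ker Q : prime_ideal T Q -> M `<=` Q -> Q = M.
Proof.
move=> [hQ Q1 _] MQ; apply/seteqP; split=> // x Qx; have Tx := ideal_sub hQ Qx.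
split=> //=; apply/eqP/negPn/negP => px; apply: Q1.
have [w Tw ew] := rh_surj hT (psi x)^-1.
have Twx : T (w * x) by exact: subringM.
rewrite -(subrK (w * x) 1); apply: (idealD hQ); last exact: (idealMl hQ).
apply: MQ; split; first by apply: subringB => //; exact: subring1.
rewrite /= (rhB hT)//; last exact: subring1.
by rewrite (rhM hT)// (rh1 hT) ew mulVf// subrr.
Qed.

Lemma ker_prime : prime_ideal T M.
Proof.
rewrite -[X in prime_ideal X](pullbackT T psi).
have KT : is_subring [set: K] by apply/is_subringP.
exact/(pullback_prime hT)/prime_zero.
Qed.

(** The statement for subrings [T] and [V = T_M] of an arbitrary field, which
    need not be their quotient field. *)
Theorem locally_GK_pullback : D <> setT ->
  locally (@GK_domain F) R <->
  [/\ locally (@GK_domain K) D, locally (@GK_domain F) T,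
      valuation_domain (localization T M) & quotient_field D = setT].
Proof.
move=> Dn; rewrite localization_ker; split=> [gkR|[gkD gkT valV qD]].
  have gkL p : prime_ideal D p -> GK_domain (pullback V psi (localization D p)).
    move=> ppr; rewrite -localization_pullback_above//.
    by apply: gkR; exact: (pullback_prime hT).
  have subL p : prime_ideal D p -> is_subring (localization D p).
    by move=> /gkL[/(pullback_subring hV)].
  have [p ppr pn] := exists_prime_localization_neqT hD Dn.
  have qL q : prime_ideal D q ->
      quotient_field (localization D q) = quotient_field D.
    move=> [hq q1 _]; apply: quotient_field_localization => //.
    exact: (ideal0 hq).
  have [valV] := GK_pullback_valuation hV lV (subL _ ppr) pn (gkL _ ppr).
  rewrite qL// => qD; split=> //.
    move=> q qpr; have [->|qn] := pselect (localization D q = setT).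
      exact: GK_field.
    apply: (GK_residue_of_pullback hV lV) (gkL _ qpr) => //; first exact: subL.
    by rewrite qL.
  move=> Q Qpr; have [MQ|/nonsubset[c [Mc Qc]]] := pselect (M `<=` Q).
    rewrite (prime_above_ker Qpr MQ) localization_ker -(pullbackT V psi) -qD.
    by rewrite -quotient_field_zero; apply/gkL/prime_zero.
  rewrite -(localization_pullback_away Qpr Mc Qc).
  exact/gkR/prime_trace.
have gkV : GK_domain V.
  by rewrite -localization_ker; apply: gkT; exact: ker_prime.
move=> P Ppr; have hP := prime_is_ideal Ppr.
have [MP|/nonsubset[c [Mc Pc]]] := pselect (M `<=` P); last first.
  have [Q [Qpr Qc <-]] := prime_extend Ppr Mc Pc.
  by rewrite (localization_pullback_away Qpr Mc Qc); exact: gkT.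
have ppr := image_prime hT Ppr MP.
rewrite -(pullback_image hT hP MP) localization_pullback_above//.
have [hp p1 _] := ppr; have gkp := gkD _ ppr.
have [->|pn] := pselect (localization D (psi @` P) = setT).
  by rewrite pullbackT.
apply: (GK_pullback hV lV) => //; first by case: gkp.
by rewrite quotient_field_localization//; exact: (ideal0 hp).
Qed.

End Global.

(** * The residue map on the fraction field *)

Section Fraction.
Variables (T : idomainType) (M : idealr T) (hM : maximal_idealr M).
Hypothesis M_neq0 : exists2 m : T, m \in M & m != 0.

Local Notation toF := (@tofrac T).
Local Notation TF := (range toF).
Local Notation MF := (toF @` [set` M]).
Local Notation phi := (residue_map hM).

(** The residue map of [T_M], extended by [0] to the fractions that are not in
    [T_M]. *)
Definition frac_residue (x : {fraction T}) : residue_field hM :=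
  if pselect (exists tu, tu.2 \notin M /\ x = toF tu.1 / toF tu.2) is left e
  then phi (sval (cid e)).1 / phi (sval (cid e)).2 else 0.

Lemma notin_residue u : u \notin M -> phi u != 0.
Proof. by rewrite residue_map_eq0. Qed.

Lemma notin_neq0 u : u \notin M -> toF u != 0.
Proof.
by rewrite tofrac_eq0; apply: contraNN => /eqP ->; exact: rpred0.
Qed.

Lemma tofrac_inj : injective toF.
Proof. by move=> x y /eqP; rewrite tofrac_eq => /eqP. Qed.

Lemma frac_residueE t u : u \notin M ->
  frac_residue (toF t / toF u) = phi t / phi u.
Proof.
move=> uM; rewrite /frac_residue.
case: pselect => [e|[]]; last by exists (t, u).
case: (cid e) => -[t' u'] /= [u'M /eqP].
rewrite eqr_div ?notin_neq0// -!tofracM => /eqP/tofrac_inj tu.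
by apply/eqP; rewrite eqr_div ?notin_residue// -!rmorphM tu.
Qed.

Lemma frac_residue_tofrac t : frac_residue (toF t) = phi t.
Proof.
have := @frac_residueE t 1; rewrite !rmorph1 !divr1; apply.
by rewrite idealr1.
Qed.

Lemma residue_hom_tofrac : residue_hom TF frac_residue.
Proof.
split.
- apply/is_subringP; split=> [|_ _ [x _ <-] [y _ <-]|_ _ [x _ <-] [y _ <-]].
  + by exists 1; rewrite ?rmorph1.
  + by exists (x - y); rewrite ?rmorphB.
  + by exists (x * y); rewrite ?rmorphM.
- move=> _ _ [x _ <-] [y _ <-].
  by rewrite -rmorphB !frac_residue_tofrac rmorphB.
- move=> _ _ [x _ <-] [y _ <-].
  by rewrite -rmorphM !frac_residue_tofrac rmorphM.
- by rewrite -(rmorph1 toF) frac_residue_tofrac rmorph1.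
- move=> z; have [a <-] := residue_map_surj z; exists (toF a).
    by exists a.
  exact: frac_residue_tofrac.
Qed.

Local Notation V := (localization TF MF).

Lemma localization_fracP x :
  V x <-> exists t u, u \notin M /\ x = toF t / toF u.
Proof.
split=> [[_ [_ [[t _ <-] [u _ <-] uM ->]]]|[t [u [uM ->]]]].
  by exists t, u; split=> //; apply/negP => Mu; apply: uM; exists u.
exists (toF t), (toF u); split=> // -[v /= vM /tofrac_inj e].
by move: uM; rewrite -e vM.
Qed.

Lemma residue_hom_localization : residue_hom V frac_residue.
Proof.
have mulN u v : u \notin M -> v \notin M -> u * v \notin M.
  move=> /notin_residue u0 /notin_residue v0.
  by rewrite -(residue_map_eq0 hM) rmorphM mulf_neq0.
have sub_frac t u t' u' : u \notin M -> u' \notin M ->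
    toF t / toF u - toF t' / toF u' = toF (t * u' - t' * u) / toF (u * u').
  by move=> /notin_neq0 u0 /notin_neq0 u'0; rewrite -mulNr addf_div//
    rmorphB !rmorphM mulNr.
have mul_frac t u t' u' :
    (toF t / toF u) * (toF t' / toF u') = toF (t * t') / toF (u * u').
  by rewrite mulf_div !rmorphM.
split.
- apply/is_subringP; split.
  + apply/localization_fracP; exists 1, 1; rewrite idealr1; split=> //.
    by rewrite !rmorph1 divr1.
  + move=> _ _ /localization_fracP[t [u [uM ->]]]
      /localization_fracP[t' [u' [u'M ->]]].
    rewrite sub_frac//; apply/localization_fracP.
    by exists (t * u' - t' * u), (u * u'); rewrite mulN.
  + move=> _ _ /localization_fracP[t [u [uM ->]]]
      /localization_fracP[t' [u' [u'M ->]]].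
    rewrite mul_frac; apply/localization_fracP.
    by exists (t * t'), (u * u'); rewrite mulN.
- move=> _ _ /localization_fracP[t [u [uM ->]]]
    /localization_fracP[t' [u' [u'M ->]]].
  rewrite sub_frac// !frac_residueE ?mulN// -[- (phi t' / _)]mulNr.
  rewrite addf_div ?notin_residue//.
  by rewrite rmorphB !rmorphM mulNr.
- move=> _ _ /localization_fracP[t [u [uM ->]]]
    /localization_fracP[t' [u' [u'M ->]]].
  by rewrite mul_frac !frac_residueE ?mulN// mulf_div !rmorphM.
- exact: (rh1 residue_hom_tofrac).
- move=> z; have [x [t _ <-] e] := rh_surj residue_hom_tofrac z.
  exists (toF t) => //; apply/localization_fracP; exists t, 1.
  by rewrite idealr1 rmorph1 divr1.
Qed.

Lemma local_residue_localization : local_residue V frac_residue.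
Proof.
split.
  move=> _ /localization_fracP[t [u [uM ->]]].
  rewrite frac_residueE// mulf_eq0 negb_or residue_map_eq0 => /andP[tM _].
  by apply/localization_fracP; exists u, t; rewrite invf_div.
have [m mM m0] := M_neq0; exists (toF m); split.
- by apply/localization_fracP; exists m, 1; rewrite idealr1 rmorph1 divr1.
- by apply/eqP; rewrite frac_residue_tofrac residue_map_eq0.
- by rewrite tofrac_eq0.
Qed.

Lemma pullback_tofrac (D : set (residue_field hM)) :
  pullback TF frac_residue D = toF @` (phi @^-1` D).
Proof.
apply/seteqP; split=> [_ [[t _ <-]]|_ [t Dt <-]].
  by rewrite /= frac_residue_tofrac => Dt; exists t.
by split; [exists t|rewrite /= frac_residue_tofrac].
Qed.

Lemma pullback_tofrac_ker : pullback TF frac_residue [set 0] = MF.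
Proof.
rewrite pullback_tofrac; congr image; apply/seteqP; split=> t /=.
  by move=> /eqP; rewrite residue_map_eq0.
by move=> tM; apply/eqP; rewrite residue_map_eq0.
Qed.

End Fraction.

Unset Implicit Arguments.

Theorem theorem3p10 (T : idomainType) (M : idealr T) (hM : maximal_idealr M)
    (M_neq0 : exists2 m : T, m \in M & m != 0)
    (D : set (residue_field hM)) (D_subring : is_subring D)
    (D_proper : D <> setT) :
  let T_F : set {fraction T} := range (@tofrac T) in
  let M_F : set {fraction T} := @tofrac T @` [set` M] in
  let R : set T := residue_map hM @^-1` D in
  let R_F : set {fraction T} := @tofrac T @` R in
  locally (@GK_domain _) R_F <->
  [/\ locally (@GK_domain _) D, locally (@GK_domain _) T_F,
      valuation_domain (localization T_F M_F) & quotient_field D = setT].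
Proof.
move=> T_F M_F R R_F.
rewrite /R_F /R -pullback_tofrac /M_F -(pullback_tofrac_ker hM).
have hV := residue_hom_localization hM.
have lV := local_residue_localization hM M_neq0.
apply: (locally_GK_pullback hV lV (residue_hom_tofrac hM)) => //.
- move=> _ [t _ <-]; apply/localization_fracP; exists t, 1.
  by rewrite idealr1 rmorph1 divr1.
- move=> _ /localization_fracP[t [u [uM ->]]].
  exists (@tofrac T t), (@tofrac T u).
  split; [by exists t|by exists u| |by []].
  by rewrite frac_residue_tofrac residue_map_eq0.
Qed.
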